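(* Let $X$ be an algebraic surface over an algebraically closed field $k$, let $x\in X$ be a normal closed point, and let $\pi:\mathrm{RZ}(X,x)\to\mathrm{NL}(X,x)$ be the canonical continuous map (defined in the context). Let $q:\mathrm{RZ}(X,x)\to\mathrm{H}$ be the largest Hausdorff quotient of $\mathrm{RZ}(X,x)$, and let $\tilde\pi:\mathrm{H}\to\mathrm{NL}(X,x)$ be the unique continuous map with $\tilde\pi\circ q=\pi$. Then $\tilde\pi$ is a homeomorphism.
   Context: An algebraic surface over $k$ is an integral separated scheme of finite type over $k$ of dimension 2. Let $K$ be the function field of $X$, $\mathcal{O}_{X,x}$ the local ring at $x$ and $\mathfrak{m}_{X,x}$ its maximal ideal. For a valuation $\nu$ of $K$, $R_\nu$ is its valuation ring and $m_\nu$ the maximal ideal of $R_\nu$. Riemann--Zariski space: $\mathrm{RZ}(X,x)$ is the set of all valuations $\nu$ of $K$ (of arbitrary rank, up to equivalence) that are trivial on $k$ and whose valuation ring dominates $\mathcal{O}_{X,x}$, i.e. $\mathcal{O}_{X,x}\subseteq R_\nu$ and $m_\nu\cap\mathcal{O}_{X,x}=\mathfrak{m}_{X,x}$ (one says $\nu$ is centered in $x$). It carries the topology with basis the sets $\{\nu : A\subset R_\nu\}$, $A$ a finite subset of $K$. Normalized non-Archimedean link: $\mathrm{NL}(X,x)$ is (identified with) the set of all maps $v:\mathcal{O}_{X,x}\to[0,+\infty]$ such that $v(0)=+\infty$, $v|_{k^*}=0$, $v(fg)=v(f)+v(g)$ and $v(f+g)\ge\min\{v(f),v(g)\}$ for all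 $f,g$, and $v(\mathfrak{m}_{X,x}):=\min\{v(f): f\in\mathfrak{m}_{X,x}\}=1$. It carries the topology of pointwise convergence; it is Hausdorff. Definition of $\pi$: let $\nu\in\mathrm{RZ}(X,x)$ have rank $r\ge1$, and consider the maximal chain of valuation rings $R_\nu=R_{\nu_r}\subsetneq\dots\subsetneq R_{\nu_1}$ of $K$ (all different from $K$; $\nu_i$ has rank $i$). Let $j$ be the smallest $i\in\{1,\dots,r\}$ such that $\nu_i$ is centered in $x$. If $j=1$, regard $\nu_1$ as real valued and set $\pi(\nu)(f)=\nu_1(f)/\nu_1(\mathfrak{m}_{X,x})$ for every nonzero $f\in\mathcal{O}_{X,x}$, where $\nu_1(\mathfrak{m}_{X,x})=\min\{\nu_1(g):g\in\mathfrak{m}_{X,x}\}$. If $j>1$, let $\overline{\nu}_{j-1}$ be the (real valued) rank one valuation of the residue field of $R_{\nu_{j-1}}$ with valuation ring $R_{\nu_j}/m_{\nu_{j-1}}$; then $\pi(\nu)$ is the unique multiple by a positive real constant lying in $\mathrm{NL}(X,x)$ of the semivaluation sending $f\in\mathcal{O}_{X,x}$ to $\overline{\nu}_{j-1}(\bar f)$ if $f\notin m_{\nu_{j-1}}$ ($\bar f$ the class of $f$ in $\mathcal{O}_{X,x}/(\mathcal{O}_{X,x}\cap m_{\nu_{j-1}})$), and to $+\infty$ if $f\in m_{\nu_{j-1}}$. The map $\pi$ is continuous. Largest Hausdorff quotient: a quotient map $q:\mathrm{RZ}(X,x)\to\mathrm{H}$ onto a Hausdorff space such that every continuous map $f$ from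 $\mathrm{RZ}(X,x)$ to a Hausdorff space $Z$ factors as $f=\tilde f\circ q$ for a unique continuous $\tilde f:\mathrm{H}\to Z$. *)

(* Defs.v *)
From HB Require Import structures.
From mathcomp Require Import all_boot all_order all_algebra.
From mathcomp Require Import all_classical all_reals.
From mathcomp Require Import ereal topology normedtype.

Set Implicit Arguments.
Unset Strict Implicit.
Unset Printing Implicit Defensive.

Import Order.TTheory GRing.Theory Num.Theory.
Import numFieldNormedType.Exports.

Local Open Scope classical_set_scope.
Local Open Scope ring_scope.

(** ** Subrings of a field *)

Section Rings.
Variable K : fieldType.
Implicit Types A B P V W : set K.

(* For a local ring this is the maximal ideal. *)
Definition nonunits A : set K := [set f | A f /\ forall g, A g -> f * g <> 1].

Definition dominates B A := A `<=` B /\ nonunits B `&` A = nonunits A.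

Definition valuation_ring V :=
  subring_closed [in V] /\ forall x, x != 0 -> V x \/ V x^-1.

Definition prime_ideal A P :=
  [/\ P `<=` A, P 0, forall f g, P f -> P g -> P (f + g),
      forall a f, A a -> P f -> P (a * f) &
      ~ P 1 /\ forall a b, A a -> A b -> P (a * b) -> P a \/ P b].

Definition localization A P : set K :=
  [set x | exists a b, [/\ A a, A b, ~ P b & x = a / b]].

Definition integrally_closed A :=
  forall (p : {poly K}) (x : K),
    p \is monic -> (forall i, A p`_i) -> root p x -> A x.

End Rings.

(** ** Algebraic surfaces

    An integral separated scheme [X] of finite type over [k] with function field
    [K] is represented by the set of its local rings O_{X,x}, seen as subrings
    of [K]: this is the language of Chevalley schemes (EGA I, section 8), in
    which a point is its local ring.  [X] is covered by the spectra of finitely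
    many finitely generated [k]-subalgebras of [K] with fraction field [K], and
    separatedness says that every valuation ring of [K] has at most one center
    on [X].  A point [y] belongs to the closure of [x] if and only if
    O_{X,y} is contained in O_{X,x}. *)

Section Surfaces.
Variables (k K : fieldType) (iota : {rmorphism k -> K}).
Implicit Types (A O : set K) (X : set (set K)).

Definition subalgebra A := subring_closed [in A] /\ forall c, A (iota c).

Definition affine_ring A :=
  (exists s : seq K, A = smallest subalgebra [set` s]) /\
  forall x, exists a b, [/\ A a, A b, b != 0 & x = a / b].

Definition spectrum A : set (set K) :=
  [set localization A P | P in prime_ideal A].

Definition integral_finite_type X :=
  exists2 As : seq (set K), (forall A, A \in As -> affine_ring A) &
    X = \bigcup_(A in [set` As]) spectrum A.

Definition separated X :=
  forall V O O', valuation_ring V -> X O -> X O' ->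
    dominates V O -> dominates V O' -> O = O'.

(* Irreducible closed subsets of a scheme are the closures of its points, so
   chains of irreducible closed subsets are chains of specializations. *)
Definition specialization_chain X (n : nat) (c : nat -> set K) :=
  (forall i, (i <= n)%N -> X (c i)) /\
  (forall i, (i < n)%N -> c i.+1 `<` c i).

Definition dimension X (n : nat) :=
  (exists c, specialization_chain X n c) /\
  (forall m c, specialization_chain X m c -> (m <= n)%N).

Definition algebraic_surface X :=
  [/\ integral_finite_type X, separated X & dimension X 2].

Definition closed_point X O := X O /\ forall O', X O' -> O' `<=` O -> O' = O.

Definition normal_point X O := X O /\ integrally_closed O.

End Surfaces.

(** ** The Riemann-Zariski space

    A valuation of [K] up to equivalence is represented by its valuation
    ring. *)

Section RiemannZariski.
Variables (k K : fieldType) (iota : {rmorphism k -> K}) (O : set K).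

Definition is_RZ (V : set K) :=
  [/\ valuation_ring V, forall c, V (iota c) & dominates V O].

Definition RZ : Type := {V : set K | is_RZ V}.

Definition RZ_ring (nu : RZ) : set K := sval nu.

HB.instance Definition _ := gen_eqMixin RZ.
HB.instance Definition _ := gen_choiceMixin RZ.

Definition RZ_basic (A : set K) : set RZ := [set nu | A `<=` RZ_ring nu].

Lemma RZ_basic_cover :
  \bigcup_(A in [set A : set K | finite_set A]) RZ_basic A = setT.
Proof.
rewrite -subTset => nu _.
by exists set0; [exact: finite_set0|exact: sub0set].
Qed.

Lemma RZ_basic_join (A B : set K) (nu : RZ) :
  [set A : set K | finite_set A] A -> [set A : set K | finite_set A] B ->
  RZ_basic A nu -> RZ_basic B nu ->
  exists C, [/\ [set A : set K | finite_set A] C, RZ_basic C nu &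
    RZ_basic C `<=` RZ_basic A `&` RZ_basic B].
Proof.
move=> finA finB Anu Bnu; exists (A `|` B); split.
- by rewrite /= finite_setU.
- by rewrite /RZ_basic /= subUset.
- by move=> mu; rewrite /RZ_basic /= subUset.
Qed.

HB.instance Definition _ :=
  isBaseTopological.Build RZ RZ_basic_cover RZ_basic_join.

End RiemannZariski.

(** ** The normalized non-Archimedean link *)

Definition is_min {R : realType} {T : Type} (A : set T) (u : T -> \bar R)
    (c : \bar R) :=
  (exists2 f, A f & u f = c) /\ forall f, A f -> (c <= u f)%E.

Section Link.
Variables (R : realType) (k K : fieldType) (iota : {rmorphism k -> K}).
Variable O : set K.

Definition is_NL (v : {ptws O -> \bar R}) :=
  [/\ forall f, (0 <= v f)%E,
      forall f, set_val f = 0 -> v f = +oo%E,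
      forall (f : O) c, c != 0 -> set_val f = iota c -> v f = 0%E,
      (forall f g h : O, set_val h = set_val f * set_val g ->
         v h = (v f + v g)%E) /\
      (forall f g h : O, set_val h = set_val f + set_val g ->
         (Order.min (v f) (v g) <= v h)%E) &
      is_min [set f : O | nonunits O (set_val f)] v 1%:E].

(* [set_type] carries the induced topology. *)
Definition NL : topologicalType :=
  set_type [set v : {ptws O -> \bar R} | is_NL v].

Definition NL_val (v : NL) : O -> \bar R := set_val v.

End Link.

(** ** The canonical map from RZ to NL *)

Definition real_valuation {R : realType} {F : fieldType} (w : F -> \bar R)
    (V : set F) :=
  [/\ w 0 = +oo%E,
      forall x, x != 0 -> w x \is a fin_num,
      forall x y, w (x * y) = (w x + w y)%E,
      forall x y, (Order.min (w x) (w y) <= w (x + y)%R)%E &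
      V = [set x | (0 <= w x)%E]].

Section CanonicalMap.
Variables (R : realType) (k K : fieldType) (iota : {rmorphism k -> K}).
Variable O : set K.

(* [W 1], ..., [W r] are all the valuation rings other than [K] that contain
   [V], listed in decreasing order. *)
Definition maximal_chain (V : set K) (r : nat) (W : nat -> set K) :=
  [/\ (0 < r)%N /\ W r = V,
      forall i, (0 < i <= r)%N -> valuation_ring (W i) /\ W i <> setT,
      forall i, (0 < i < r)%N -> W i.+1 `<` W i &
      forall S, valuation_ring S -> S <> setT -> V `<=` S ->
        exists2 i, (0 < i <= r)%N & S = W i].

(* [rho], restricted to [W], exhibits [F] as the residue field of [W]. *)
Definition residue_map (W : set K) (F : fieldType) (rho : K -> F) :=
  [/\ rho 1 = 1,
      forall x y, W x -> W y -> rho (x + y) = rho x + rho y,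
      forall x y, W x -> W y -> rho (x * y) = rho x * rho y,
      forall z, exists2 x, W x & rho x = z &
      forall x, W x -> (rho x = 0 <-> nonunits W x)].

Definition image_by_rank_one (W : set K) (v : O -> \bar R) :=
  exists (w : K -> \bar R) (c : R),
    [/\ real_valuation w W, is_min (nonunits O) w c%:E &
        forall f : O, set_val f != 0 ->
          v f = (w (set_val f) * c^-1%:E)%E].

(* [W'] is the valuation ring one step below [W] in the chain.  The constant
   [a] is determined by the normalization of [v]. *)
Definition image_by_residue (W W' : set K) (v : O -> \bar R) :=
  exists (F : fieldType) (rho : K -> F) (w : F -> \bar R) (a : R),
    [/\ residue_map W rho, real_valuation w (rho @` W'), 0 < a,
        forall f : O, ~ nonunits W (set_val f) ->
          v f = (a%:E * w (rho (set_val f)))%E &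
        forall f : O, nonunits W (set_val f) -> v f = +oo%E].

Definition is_image (nu : RZ iota O) (v : NL R iota O) :=
  exists (r : nat) (W : nat -> set K) (j : nat),
    [/\ maximal_chain (RZ_ring nu) r W,
        (0 < j <= r)%N,
        dominates (W j) O,
        forall i, (0 < i < j)%N -> ~ dominates (W i) O &
        if j == 1%N then image_by_rank_one (W 1%N) (NL_val v)
        else image_by_residue (W j.-1) (W j) (NL_val v)].

Definition canonical_map (pi : RZ iota O -> NL R iota O) :=
  forall nu, is_image nu (pi nu).

End CanonicalMap.

(** ** Topology *)

Definition quotient_map {S T : topologicalType} (q : S -> T) :=
  set_surj [set: S] [set: T] q /\ forall U : set T, open U <-> open (q @^-1` U).

Definition largest_hausdorff_quotient {S H : topologicalType} (q : S -> H) :=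
  [/\ quotient_map q, hausdorff_space H &
      forall (Z : topologicalType) (f : S -> Z),
        hausdorff_space Z -> continuous f ->
        exists! g : H -> Z, continuous g /\ f = g \o q].

Definition homeomorphism {S T : topologicalType} (f : S -> T) :=
  continuous f /\ exists g : T -> S, [/\ continuous g, cancel f g & cancel g f].

(* Main.v *)
Require Import Defs.
From HB Require Import structures.
From mathcomp Require Import all_boot all_order all_algebra.
From mathcomp Require Import all_classical all_reals.
From mathcomp Require Import ereal topology normedtype.
From mathcomp Require Import zify ring.

Set Implicit Arguments.
Unset Strict Implicit.
Unset Printing Implicit Defensive.

Import Order.TTheory GRing.Theory Num.Theory.
Import numFieldNormedType.Exports.

Local Open Scope classical_set_scope.
Local Open Scope ring_scope.

(** A point [v] of the link with kernel [P] determines the subring [link_ring v]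
    of [K] of the fractions [a / b] with [v b] finite and [v b <= v a], the
    composite of O_P with [v].  It is a valuation ring as soon as O_P is one,
    which holds when [P <> 0] because O is normal, noetherian and of dimension
    two, so that O_P is a noetherian normal domain of dimension one.  Every [nu]
    in the fibre of [pi] over [v] has its ring contained in [link_ring v], that
    is, [nu] is a specialization of the point [link_ring v] of RZ.  As points of
    H are closed, [q] is constant on the fibres of [pi]; and [pi] is onto because
    an inclusion [link_ring v `<=` link_ring v'] forces [v = v'].  Finally RZ is
    compact and NL is Hausdorff, so that the continuous bijection [pit] is a
    homeomorphism. *)

(** * Noetherian subrings of a field *)

(** Dependent choice with full memory: the list of terms already chosen is grown by [rcons]. It
    serves to pick polynomials one after another in the basis theorem. *)
Lemma seq_choice (T : Type) (P : seq T -> T -> Prop) :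
  (forall s, exists t, P s t) ->
  exists a : nat -> T, forall n, P (mkseq a n) (a n).
Proof.
move=> /choice[g gP]; pose L n := iter n (fun s => rcons s (g s)) [::].
exists (g \o L) => n; suff -> : mkseq (g \o L) n = L n by exact: gP.
by elim: n => // n IHn; rewrite mkseqS IHn.
Qed.

Lemma ex_argmin (T : Type) (P : T -> Prop) (m : T -> nat) :
  (exists t, P t) -> exists2 t, P t & forall t', P t' -> (m t <= m t')%N.
Proof.
move=> [t0 Pt0]; pose Q n := `[< exists2 t, P t & m t = n >].
have exQ : exists n, Q n by exists (m t0); apply/asboolP; exists t0.
have [_ /asboolP[t Pt <-] tmin] := ex_minnP exQ.
by exists t => // t' Pt'; apply: tmin; apply/asboolP; exists t'.
Qed.

Section Subrings.
Variable K : fieldType.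
Implicit Types (A D I P Q : set K) (s : seq K).

(** The proof of closure is an argument so that the subring structure can be attached to the
    predicate, which makes the generic closure rules available for [A]. *)
Definition subring_pred A & subring_closed [in A] : {pred K} := [in A].

HB.instance Definition _ A (hA : subring_closed [in A]) :=
  GRing.isSubringClosed.Build K (subring_pred hA) hA.

Section SubringTheory.
Variables (A : set K) (hA : subring_closed [in A]).

Lemma in_subring_pred x : x \in subring_pred hA <-> A x.
Proof. by change (x \in A <-> A x); rewrite in_setE. Qed.

Lemma subring1 : A 1.
Proof. by apply/in_subring_pred; exact: rpred1. Qed.

Lemma subring0 : A 0.
Proof. by apply/in_subring_pred; exact: rpred0. Qed.

Lemma subringD x y : A x -> A y -> A (x + y).
Proof. by rewrite -!in_subring_pred; exact: rpredD. Qed.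

Lemma subringN x : A x -> A (- x).
Proof. by rewrite -!in_subring_pred rpredN. Qed.

Lemma subringM x y : A x -> A y -> A (x * y).
Proof. by rewrite -!in_subring_pred; exact: rpredM. Qed.

Lemma subringX x n : A x -> A (x ^+ n).
Proof. by rewrite -!in_subring_pred => Ax; exact: rpredX. Qed.

Lemma subring_sum n (F : nat -> K) :
  (forall i, (i < n)%N -> A (F i)) -> A (\sum_(i < n) F i).
Proof.
by move=> AF; apply/in_subring_pred/rpred_sum => i _; apply/in_subring_pred/AF.
Qed.

Lemma polyOver_subringP (p : {poly K}) :
  p \is a polyOver (subring_pred hA) <-> forall i, A p`_i.
Proof.
split=> [/polyOverP Ap i|Ap]; first exact/in_subring_pred.
by apply/polyOverP => i; apply/in_subring_pred.
Qed.

End SubringTheory.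

Lemma subringP A :
  A 1 -> (forall x y, A x -> A y -> A (x - y)) ->
  (forall x y, A x -> A y -> A (x * y)) -> subring_closed [in A].
Proof.
move=> A1 AB AM; split; first by rewrite in_setE.
  by move=> x y; rewrite !in_setE; exact: AB.
by move=> x y; rewrite !in_setE; exact: AM.
Qed.

(** * Ideals, the ascending chain condition and integrality *)

Definition ideal A I :=
  [/\ I `<=` A, I 0, forall f g, I f -> I g -> I (f + g) &
      forall a f, A a -> I f -> I (a * f)].

Definition span A s : set K :=
  [set y | exists2 c : nat -> K, forall i, A (c i) &
    y = \sum_(i < size s) c i * s`_i].

Definition noetherian A := forall I, ideal A I -> exists s, I = span A s.

Lemma prime_ideal_ideal A P : prime_ideal A P -> ideal A P.
Proof. by case. Qed.

Section Ideals.
Variables (A : set K) (hA : subring_closed [in A]).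

Lemma ideal_sum I n (F : nat -> K) : ideal A I ->
  (forall i, (i < n)%N -> I (F i)) -> I (\sum_(i < n) F i).
Proof.
case=> _ I0 ID _ IF; elim: n IF => [|n IHn] IF; first by rewrite big_ord0.
by rewrite big_ord_recr /=; apply: ID; [apply: IHn => i /ltnW|]; exact: IF.
Qed.

Lemma idealB I x y : ideal A I -> I x -> I y -> I (x - y).
Proof.
move=> [_ _ ID IM] Ix Iy; apply: ID => //; rewrite -mulN1r; apply: IM => //.
exact/(subringN hA)/(subring1 hA).
Qed.

Lemma span_min I s : ideal A I -> (forall x, x \in s -> I x) ->
  span A s `<=` I.
Proof.
move=> hI sI _ [c Ac ->].
apply: (ideal_sum (F := fun i => c i * s`_i)) => // i lti.
by case: hI => _ _ _; apply => //; apply: sI; exact: mem_nth.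
Qed.

Lemma mem_span s x : x \in s -> span A s x.
Proof.
move=> xs; exists (fun i => (i == index x s)%:R) => [i|].
  by case: eqP => _; [exact: subring1|exact: subring0].
rewrite (bigD1 (Ordinal (etrans (index_mem x s) xs))) //= eqxx mul1r.
rewrite nth_index //.
rewrite big1 ?addr0 // => i; rewrite -val_eqE /= => /negPf->.
by rewrite mul0r.
Qed.

Lemma span_ideal s : (forall x, x \in s -> A x) -> ideal A (span A s).
Proof.
move=> sA; split.
- move=> _ [c Ac ->].
  apply: (subring_sum hA (F := fun i => c i * s`_i)) => i lti.
  by apply: (subringM hA) => //; apply: sA; exact: mem_nth.
- exists (fun=> 0) => [_|]; first exact: subring0.
  by rewrite big1 // => i _; rewrite mul0r.
- move=> _ _ [c Ac ->] [d Ad ->]; exists (fun i => c i + d i) => [i|].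
    exact: subringD.
  by rewrite -big_split; apply: eq_bigr => i _; rewrite mulrDl.
- move=> a _ Aa [c Ac ->]; exists (fun i => a * c i) => [i|].
    exact: subringM.
  by rewrite mulr_sumr; apply: eq_bigr => i _; rewrite mulrA.
Qed.

Lemma span_mono s (t : seq K) : (forall x, x \in t -> A x) -> {subset s <= t} ->
  span A s `<=` span A t.
Proof.
move=> tA st; apply: span_min; first exact: span_ideal.
by move=> x /st; exact: mem_span.
Qed.

Lemma mkseq_subset (T : eqType) (a : nat -> T) m n : (m <= n)%N ->
  {subset mkseq a m <= mkseq a n}.
Proof.
move=> mn x /mapP[i]; rewrite mem_iota add0n => /= im ->.
by apply: map_f; rewrite mem_iota add0n /= (leq_trans im).
Qed.

(** The spans of the initial segments form a chain whose union is an ideal; its finitely many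
    generators all appear at one stage [N], and [a N] lies in the union. *)
Lemma noetherian_seq (a : nat -> K) : noetherian A -> (forall n, A (a n)) ->
  exists n, span A (mkseq a n) (a n).
Proof.
move=> noethA Aa.
have sA n x : x \in mkseq a n -> A x by move=> /mapP[i _ ->].
pose I : set K := [set y | exists n, span A (mkseq a n) y].
have mono m n : (m <= n)%N -> span A (mkseq a m) `<=` span A (mkseq a n).
  by move=> mn; apply: span_mono => //; [exact: sA|exact: mkseq_subset].
have hI : ideal A I.
  split.
  - by move=> y [n ny]; case: (span_ideal (@sA n)) => + _ _ _; exact.
  - by exists 0%N; case: (span_ideal (@sA 0%N)).
  - move=> f g [m fm] [n gn]; exists (maxn m n).
    case: (span_ideal (@sA (maxn m n))) => _ _ + _; apply.
      by apply: mono fm; exact: leq_maxl.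
    by apply: mono gn; exact: leq_maxr.
  - move=> b f Ab [n fn]; exists n.
    by case: (span_ideal (@sA n)) => _ _ _; apply.
have [s Is] := noethA _ hI.
have [N sN] : exists N, forall x, x \in s -> span A (mkseq a N) x.
  have : forall x, x \in s -> I x by move=> x xs; rewrite Is; exact: mem_span.
  elim: s {Is} => [|x s IHs] sI; first by exists 0%N.
  have [|N sN] := IHs; first by move=> y ys; apply: sI; rewrite inE ys orbT.
  have [n xn] := sI x (mem_head _ _).
  exists (maxn N n) => y; rewrite inE => /predU1P[->|/sN].
    by apply: mono xn; exact: leq_maxr.
  by apply: mono; exact: leq_maxl.
exists N; apply: (span_min (span_ideal (@sA N)) sN); rewrite -Is.
exists N.+1; apply: mem_span.
by apply: map_f; rewrite mem_iota /= add0n.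
Qed.

(** Without a maximal member, choice builds an increasing chain with an element [a n] new at each
    step, against [noetherian_seq]. *)
Lemma noetherian_maximal (T : Type) (P : T -> Prop) (I : T -> set K) :
  noetherian A -> (forall t, P t -> ideal A (I t)) -> (exists t, P t) ->
  exists2 t, P t & forall t', P t' -> I t `<=` I t' -> I t' `<=` I t.
Proof.
move=> noethA hI [t0 Pt0]; apply: contrapT => nomax.
have step (u : {t | P t}) : exists v : {t | P t} * K,
    [/\ I (sval u) `<=` I (sval v.1), I (sval v.1) v.2 & ~ I (sval u) v.2].
  case: u => t Pt /=; apply: contrapT => nov; apply: nomax; exists t => //.
  move=> t' Pt' tt' y t'y; apply: contrapT => nty; apply: nov.
  by exists (exist _ t' Pt', y).
have /choice[g gP] := step.
pose u n := iter n (fun u => (g u).1) (exist _ t0 Pt0).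
pose a n := (g (u n)).2.
have mono m n : (m <= n)%N -> I (sval (u m)) `<=` I (sval (u n)).
  elim: n => [|n IHn]; first by rewrite leqn0 => /eqP->.
  rewrite leq_eqVlt => /predU1P[->//|]; rewrite ltnS => /IHn mn.
  by apply: (subset_trans mn); case: (gP (u n)).
have uI n : ideal A (I (sval (u n))) by apply: hI; case: (u n).
have Ia n : I (sval (u n.+1)) (a n) by case: (gP (u n)).
have [|n] := @noetherian_seq a noethA.
  by move=> n; case: (uI n.+1) => + _ _ _; apply.
case: (gP (u n)) => _ _ nIa san; apply: nIa.
apply: (span_min (uI n)) san => x /mapP[i]; rewrite mem_iota add0n => /= lin ->.
exact: (mono i.+1).
Qed.

(* Cayley-Hamilton: multiplication by [x] on the span of [s] is given by a
   matrix over [A], whose characteristic polynomial vanishes at [x]. *)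
Lemma span_stable_integral s x : (exists2 y, y \in s & y != 0) ->
  (forall y, y \in s -> span A s (y * x)) ->
  exists p : {poly K}, [/\ p \is monic, forall i, A p`_i & root p x].
Proof.
move=> [y ys y0] sx; set n := size s.
have /choice[c cP] : forall i : 'I_n, exists c : nat -> K,
    (forall j, A (c j)) /\ s`_i * x = \sum_(j < n) c j * s`_j.
  move=> i; have [c Ac eqc] := sx _ (mem_nth 0 (ltn_ord i)).
  by exists c.
pose B : 'M[K]_n := \matrix_(j, i) c i j.
pose v : 'rV[K]_n := \row_i s`_i.
(* The row of the elements of [s] is the eigenvector; it is nonzero because [y] is one of its
   entries. *)
have /eigenvalueP : exists2 v : 'rV[K]_n, v *m B = x *: v & v != 0.
  exists v.
    apply/rowP => i; rewrite !mxE mulrC (cP i).2.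
    by apply: eq_bigr => j _; rewrite !mxE mulrC.
  apply: contra y0 => /eqP/rowP/(_ (Ordinal (etrans (index_mem y s) ys))).
  by rewrite !mxE /= nth_index // => ->.
rewrite eigenvalue_root_char => rx; exists (char_poly B); split => //.
  exact: char_poly_monic.
apply/(polyOver_subringP hA); rewrite /char_poly /determinant.
apply: rpred_sum => f _; apply: rpredM.
  by rewrite rpredX // rpredN rpred1.
apply: rpred_prod => i _; rewrite !mxE; apply: rpredB.
  by rewrite rpredMn // polyOverX.
by rewrite polyOverC; apply/in_subring_pred; exact: (cP _).1.
Qed.

End Ideals.

(** * Adjoining an element to a noetherian ring *)

Definition adjoin A x : set K :=
  [set p.[x] | p in [set p : {poly K} | forall i, A p`_i]].

Lemma adjoin_subring A x : subring_closed [in A] ->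
  subring_closed [in adjoin A x].
Proof.
move=> hA; apply: subringP.
- exists 1; last by rewrite hornerC.
  by apply/(polyOver_subringP hA); exact: rpred1.
- move=> _ _ [p + <-] [q + <-]; rewrite /= -!(polyOver_subringP hA) => Ap Aq.
  exists (p - q); last by rewrite hornerD hornerN.
  by apply/(polyOver_subringP hA); exact: rpredB.
- move=> _ _ [p + <-] [q + <-]; rewrite /= -!(polyOver_subringP hA) => Ap Aq.
  exists (p * q); last by rewrite hornerM.
  by apply/(polyOver_subringP hA); exact: rpredM.
Qed.

Lemma sub_adjoin A x : subring_closed [in A] -> A `<=` adjoin A x.
Proof.
move=> hA y Ay; exists y%:P; last by rewrite hornerC.
by apply/(polyOver_subringP hA); rewrite polyOverC; apply/in_subring_pred.
Qed.

Lemma mem_adjoin A x : subring_closed [in A] -> adjoin A x x.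
Proof.
move=> hA; exists 'X; last by rewrite hornerX.
by apply/(polyOver_subringP hA); exact: polyOverX.
Qed.

(* Hilbert's basis theorem: if no finite set generated the ideal, then choose
   polynomials [q n] of minimal degree with value outside the span of the
   previous values; a relation between their leading coefficients allows one
   to lower the degree. *)
Lemma noetherian_adjoin A x : subring_closed [in A] -> noetherian A ->
  noetherian (adjoin A x).
Proof.
move=> hA noethA I hI; apply: contrapT => notfg.
have hB := adjoin_subring x hA; set B := adjoin A x in hI hB notfg.
have IB : I `<=` B by case: hI.
pose J (p : {poly K}) := (forall i, A p`_i) /\ I p.[x].
pose new (s : seq {poly K}) p := J p /\ ~ span B [seq q.[x] | q <- s] p.[x].
pose Pq (s : seq {poly K}) p := (forall q, q \in s -> J q) ->
  new s p /\ forall p', new s p' -> (size p <= size p')%N.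
have /seq_choice[q qP] : forall s : seq {poly K}, exists p, Pq s p.
  (* For a list with an entry outside [J] the condition [Pq] is vacuous and 0 is a default; [qJ]
     shows by strong induction that such lists never occur. *)
  move=> s; have [sJ|sJ] := pselect (forall q, q \in s -> J q); last by exists 0.
  have sI y : y \in [seq q.[x] | q <- s] -> I y.
    by move=> /mapP[r /sJ[_ Ir] ->].
  have [t [It nt]] : exists t, I t /\ ~ span B [seq q.[x] | q <- s] t.
    apply: contrapT => nt; apply: notfg; exists [seq q.[x] | q <- s].
    apply/seteqP; split; last exact: (span_min hI sI).
    by move=> y Iy; apply: contrapT => ny; apply: nt; exists y.
  have [p Ap pt] := IB _ It.
  have [|r rnew rmin] := @ex_argmin _ (new s) (size \o (@polyseq K)).
    by exists p; rewrite /new /J pt.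
  by exists r.
have qJ n : J (q n).
  have [m lt_nm] := ubnP n; elim: m n lt_nm => // m IHm n lt_nm.
  have [|[]//] := qP n.
  move=> ? /mapP[i]; rewrite mem_iota add0n => /= lt_in ->.
  by apply: IHm; lia.
have sJ n r : r \in mkseq q n -> J r by move=> /mapP[i _ ->].
have sB n y : y \in [seq r.[x] | r <- mkseq q n] -> B y.
  by move=> /mapP[r /sJ[_ Ir] ->]; exact: IB.
have Sid n := span_ideal hB (@sB n).
have qnew n : ~ span B [seq r.[x] | r <- mkseq q n] (q n).[x].
  by case: (qP n (@sJ n)) => -[].
have qmin n p : new (mkseq q n) p -> (size (q n) <= size p)%N.
  by case: (qP n (@sJ n)) => _; exact.
have q0 n : (0 < size (q n))%N.
  rewrite size_poly_gt0; apply/eqP => qn0; apply: (qnew n).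
  by rewrite qn0 horner0; case: (Sid n).
(* For [m <= n], [q n] was already a candidate at stage [m], where [q m] has minimal size. *)
have qsz m n : (m <= n)%N -> (size (q m) <= size (q n))%N.
  move=> mn; apply: (qmin m); split; first exact: qJ.
  move=> spm; apply: (qnew n); apply: (span_mono hB (@sB n)) spm.
  move=> ? /mapP[r rm ->]; apply: map_f.
  exact: mkseq_subset mn _ rm.
have [|N [c Ac]] := @noetherian_seq A hA (fun n => lead_coef (q n)) noethA.
  by move=> n; rewrite lead_coefE; case: (qJ n).
rewrite size_mkseq => eqN.
(* Shifting by [d i] brings the leading term of [q i] to the degree of [q N]; by [qsz] the truncated
   subtraction is exact for [i < N]. *)
pose d i := (size (q N) - size (q i))%N.
pose S := \sum_(i < N) c i *: (q i * 'X^(d i)).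
have AS : S \is a polyOver (subring_pred hA).
  apply: rpred_sum => i _; rewrite polyOverZ //; first exact/in_subring_pred.
  by rewrite rpredM ?polyOverXn //; apply/polyOver_subringP; case: (qJ i).
have SN : span B [seq r.[x] | r <- mkseq q N] S.[x].
  rewrite /S horner_sum.
  apply: (ideal_sum (F := fun i => (c i *: (q i * 'X^(d i))).[x]) (Sid N)).
  move=> i iN.
  rewrite hornerZ hornerM hornerXn.
  have -> : c i * ((q i).[x] * x ^+ d i) = (c i * x ^+ d i) * (q i).[x] by ring.
  case: (Sid N) => _ _ _; apply.
    apply: (subringM hB); first exact/(sub_adjoin _ hA)/Ac.
    exact/(subringX hB _)/(mem_adjoin _ hA).
  by apply/(mem_span hB)/map_f/map_f; rewrite mem_iota add0n.
have IS : I S.[x].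
  apply: (span_min hI) SN => ? /mapP[r /sJ[_ Ir] ->] //.
have rnew : new (mkseq q N) (q N - S).
  split; [split|].
  - apply/(polyOver_subringP hA); rewrite rpredB //.
    by apply/polyOver_subringP; case: (qJ N).
  - rewrite hornerD hornerN; apply: (idealB hB hI) => //; by case: (qJ N).
  - rewrite hornerD hornerN => sp; apply: (qnew N).
    rewrite -[_.[x]](subrK S.[x]).
    by case: (Sid N) => _ _ + _; apply.
have := qmin _ _ rnew; apply/negP; rewrite -ltnNge.
(* At index [(size (q N)).-1] the leading terms of [q N] and [S] cancel by [eqN]; beyond it both
   have zero coefficients. *)
rewrite -(prednK (q0 N)) ltnS; apply/leq_sizeP => j ltj.
rewrite coefB /S coef_sum.
have [->|nej] := eqVneq j (size (q N)).-1.
  rewrite -lead_coefE eqN; apply/eqP; rewrite subr_eq0; apply/eqP.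
  apply: eq_bigr => i _; rewrite nth_mkseq // coefZ coefMXn lead_coefE.
  have := qsz i N (ltnW (ltn_ord i)); have := q0 i; have := q0 N; rewrite /d.
  by move=> h1 h2 h3; case: ifP => [|_]; [lia|congr (_ * _`__); lia].
have ltNj : (size (q N) <= j)%N.
  by rewrite -(prednK (q0 N)) ltn_neqAle eq_sym nej.
rewrite nth_default //.
rewrite big1 ?subr0 // => i _; rewrite coefZ coefMXn.
have := qsz i N (ltnW (ltn_ord i)); have := q0 i; have := q0 N; rewrite /d.
move=> h1 h2 h3; case: ifP => [|_]; first by rewrite mulr0.
rewrite nth_default ?mulr0 //; move: h3 ltNj.
by move: (size (q N)) (size (q i)) => a b; lia.
Qed.

End Subrings.

(** * Finitely generated algebras over a field *)

Section FiniteType.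
Variables (k K : fieldType) (iota : {rmorphism k -> K}).

Lemma noetherian_range : noetherian (range iota).
Proof.
move=> I hI; have [IR I0 _ IM] := hI.
have [[y Iy y0]|noy] := pselect (exists2 y, I y & y != 0).
  exists [:: y]; apply/seteqP; split; last first.
    by apply: (span_min hI) => z; rewrite inE => /eqP->.
  move=> z Iz; have [[d _ dz] [c _ cy]] := (IR _ Iz, IR _ Iy).
  exists (fun=> z / y); last by rewrite big_ord1 /= divfK.
  by move=> _; exists (d / c); rewrite // fmorph_div dz cy.
exists [::]; apply/seteqP; split; last exact: (span_min hI).
move=> z Iz; exists (fun=> 0); first by move=> _; exists 0; rewrite ?rmorph0.
by rewrite big_ord0; apply/eqP/negP => /negP z0; apply: noy; exists z.
Qed.

Lemma subalgebra_range : subalgebra iota (range iota).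
Proof.
split; last by move=> c; exists c.
apply: subringP; first by exists 1; rewrite ?rmorph1.
  by move=> _ _ [c _ <-] [d _ <-]; exists (c - d); rewrite ?rmorphB.
by move=> _ _ [c _ <-] [d _ <-]; exists (c * d); rewrite ?rmorphM.
Qed.

Lemma subalgebra_smallest (s : seq K) :
  subalgebra iota (smallest (subalgebra iota) [set` s]).
Proof.
split; last by move=> c A [[_ Ac] _]; exact: Ac.
apply: subringP => [A [[hA _] _]|x y sx sy A hA|x y sx sy A hA].
- exact: subring1.
- have [[Ar _] _] := hA; apply: (subringD Ar); first exact: sx.
  by apply: (subringN Ar); exact: sy.
- have [[Ar _] _] := hA; apply: (subringM Ar); first exact: sx.
  exact: sy.
Qed.

(** The generators are adjoined one at a time to the image of [k], a field, with the basis theorem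
    applied at each step. *)
Lemma noetherian_smallest_subalgebra (s : seq K) :
  noetherian (smallest (subalgebra iota) [set` s]).
Proof.
elim: s => [|x s IHs].
  rewrite (_ : smallest _ _ = range iota); first exact: noetherian_range.
  apply/seteqP; split.
    by apply: smallest_sub; [exact: subalgebra_range|move=> y].
  by move=> _ [c _ <-] A [[_ Ac] _]; exact: Ac.
have [hA Ac] := subalgebra_smallest s.
set A := smallest _ [set` s] in IHs hA Ac.
rewrite (_ : smallest _ _ = adjoin A x); first exact: noetherian_adjoin.
apply/seteqP; split.
  apply: smallest_sub.
    by split; [exact: adjoin_subring|move=> c; exact/(sub_adjoin x hA)].
  move=> y /=; rewrite inE => /predU1P[->|ys]; first exact: mem_adjoin.
  by apply: (sub_adjoin x hA) => B [_]; exact.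
move=> _ [p Ap <-] B [[hB Bc] sB]; apply/(in_subring_pred hB)/rpred_horner.
  apply/(polyOver_subringP hB) => i; apply: (Ap i); split=> //.
  by move=> y /= ys; apply: sB; rewrite /= inE ys orbT.
by apply/in_subring_pred/sB; rewrite /= mem_head.
Qed.

End FiniteType.

(** * Localization *)

Section Localization.
Variables (K : fieldType) (A : set K) (hA : subring_closed [in A]).
Implicit Types P Q : set K.

Lemma prime_neq0 P x : prime_ideal A P -> ~ P x -> x != 0.
Proof. by case=> _ P0 _ _ _ nPx; apply: contra_notN nPx => /eqP->. Qed.

Lemma localization_subring P : prime_ideal A P ->
  subring_closed [in localization A P].
Proof.
move=> hP; have [_ _ _ _ [P1 Pp]] := hP; apply: subringP.
- by exists 1, 1; rewrite divr1; split=> //; exact: subring1.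
- move=> _ _ [a [b [Aa Ab nb ->]]] [c [d [Ac Ad nd ->]]].
  exists (a * d - c * b), (b * d); split; first 2 last.
  + by move=> /(Pp _ _ Ab Ad)[].
  + by field; rewrite !(prime_neq0 hP).
  + apply: (subringD hA); first exact: (subringM hA).
    exact/(subringN hA)/(subringM hA).
  + exact: subringM.
- move=> _ _ [a [b [Aa Ab nb ->]]] [c [d [Ac Ad nd ->]]].
  exists (a * c), (b * d); split; first 2 last.
  + by move=> /(Pp _ _ Ab Ad)[].
  + by field; rewrite !(prime_neq0 hP).
  + exact: subringM.
  + exact: subringM.
Qed.

Lemma sub_localization P : prime_ideal A P -> A `<=` localization A P.
Proof.
move=> [_ _ _ _ [P1 _]] a Aa; exists a, 1.
by rewrite divr1; split => //; exact: subring1.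
Qed.

Lemma localization_inv P b : prime_ideal A P -> A b -> ~ P b ->
  localization A P b^-1.
Proof.
by move=> hP Ab nb; exists 1, b; rewrite div1r; split=> //; exact: subring1.
Qed.

Lemma localization_mono P Q : Q `<=` P ->
  localization A P `<=` localization A Q.
Proof. by move=> QP _ [a [b [Aa Ab nb ->]]]; exists a, b; split=> // /QP. Qed.

(** An element of [P] outside [Q] is invertible at [Q] but not at [P]. This turns chains of primes
    into chains of specializations. *)
Lemma localization_proper P Q : prime_ideal A P -> prime_ideal A Q ->
  Q `<` P -> localization A P `<` localization A Q.
Proof.
move=> hP hQ [QP nPQ]; split; first exact: localization_mono.
move=> sub; apply: nPQ => f Pf; apply: contrapT => nQf.
have [PA _ _ PM _] := hP; have f0 := prime_neq0 hQ nQf.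
have [a [b [Aa Ab nb /(congr1 ( *%R^~ b))]]] :=
  sub _ (localization_inv hQ (PA _ Pf) nQf).
rewrite divfK ?(prime_neq0 hP nb) // => eqa; apply: nb.
by rewrite -(mulVKf f0 b) eqa mulrC; exact: PM.
Qed.

(** For [P] prime, the maximal ideal of the local ring at [P]: the lemmas below show that it is
    prime and that the elements outside it are units. *)
Definition localized_ideal P : set K :=
  [set x | exists a b, [/\ P a, A b, ~ P b & x = a / b]].

Lemma localized_ideal_prime P : prime_ideal A P ->
  prime_ideal (localization A P) (localized_ideal P).
Proof.
move=> hP; have [PA P0 PD PM [P1 Pp]] := hP; split.
- by move=> _ [a [b [Pa Ab nb ->]]]; exists a, b; split=> //; exact: PA.
- by exists 0, 1; rewrite mul0r; split=> //; exact: subring1.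
- move=> _ _ [a [b [Pa Ab nb ->]]] [c [d [Pc Ad nd ->]]].
  exists (d * a + b * c), (b * d); split; first 2 last.
  + by move=> /(Pp _ _ Ab Ad)[].
  + by field; rewrite !(prime_neq0 hP).
  + by apply: PD; exact: PM.
  + exact: subringM.
- move=> _ _ [a [b [Aa Ab nb ->]]] [c [d [Pc Ad nd ->]]].
  exists (a * c), (b * d); split; first 2 last.
  + by move=> /(Pp _ _ Ab Ad)[].
  + by field; rewrite !(prime_neq0 hP).
  + exact: PM.
  + exact: subringM.
split.
  move=> [a [b [Pa Ab nb /(congr1 ( *%R^~ b))]]].
  by rewrite divfK ?(prime_neq0 hP nb) // mul1r => eqb; apply: nb; rewrite eqb.
move=> _ _ [a [b [Aa Ab nb ->]]] [c [d [Ac Ad nd ->]]] [e [f [Pe Af nf eqe]]].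
have b0 := prime_neq0 hP nb; have d0 := prime_neq0 hP nd.
have f0 := prime_neq0 hP nf.
have : P (f * (a * c)).
  suff -> : f * (a * c) = (b * d) * e by apply: PM => //; exact: subringM.
  transitivity (f * (b * d) * (a / b * (c / d))); first by field; rewrite b0 d0.
  by rewrite eqe; field.
move=> /(Pp _ _ Af (subringM hA Aa Ac))[//|/(Pp _ _ Aa Ac)[Pa|Pc]].
  by left; exists a, b.
by right; exists c, d.
Qed.

Lemma localization_unit P x : prime_ideal A P -> localization A P x ->
  ~ localized_ideal P x -> localization A P x^-1.
Proof.
move=> hP [a [b [Aa Ab nb ->]]] nx; exists b, a; rewrite invf_div; split=> //.
by move=> Pa; apply: nx; exists a, b.
Qed.

Lemma contract_prime P Q : prime_ideal A P ->
  prime_ideal (localization A P) Q -> prime_ideal A (Q `&` A).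
Proof.
move=> hP [QD Q0 QAdd QM [Q1 Qp]]; have AD := sub_localization hP; split.
- by move=> x [].
- by split=> //; exact: subring0.
- by move=> f g [Qf Af] [Qg Ag]; split; [exact: QAdd|exact: subringD].
- by move=> a f Aa [Qf Af]; split; [apply: QM => //; exact: AD|exact: subringM].
split; first by case.
move=> a b Aa Ab [/Qp[||Qa|Qb]]; try exact: AD.
  by left.
by right.
Qed.

Lemma contract_sub P Q : prime_ideal A P ->
  prime_ideal (localization A P) Q -> Q `&` A `<=` P.
Proof.
move=> hP [_ _ _ QM [Q1 _]] x [Qx Ax]; apply: contrapT => nPx; apply: Q1.
rewrite -(mulVf (prime_neq0 hP nPx)); apply: QM => //.
exact: localization_inv.
Qed.

(** Clearing a denominator moves an element of an ideal into its trace on [A], so generators of the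
    trace generate the ideal. *)
Lemma noetherian_localization P : prime_ideal A P -> noetherian A ->
  noetherian (localization A P).
Proof.
move=> hP noethA J hJ; have [JD J0 JA JM] := hJ.
have AD := sub_localization hP; have hD := localization_subring hP.
have hI : ideal A (J `&` A).
  split.
  - by move=> x [].
  - by split=> //; exact: subring0.
  - by move=> f g [Jf Af] [Jg Ag]; split; [exact: JA|exact: subringD].
  - move=> a f Aa [Jf Af]; split; last exact: subringM.
    by apply: JM => //; exact: AD.
have [s eqs] := noethA _ hI; exists s; apply/seteqP; split; last first.
  apply: (span_min hJ) => x xs.
  by have [] : (J `&` A) x by rewrite eqs; exact: mem_span.
move=> x Jx; have [a [b [Aa Ab nb eqx]]] := JD _ Jx.
have b0 := prime_neq0 hP nb.
have : (J `&` A) a.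
  split=> //; rewrite (_ : a = b * x); last by rewrite eqx; field.
  by apply: JM => //; exact: AD.
rewrite eqs => -[c Ac eqa]; exists (fun i => c i / b) => [i|].
  by exists (c i), b.
rewrite eqx eqa mulr_suml; apply: eq_bigr => i _; by field.
Qed.

Lemma common_denominator P (u : nat -> K) n : prime_ideal A P ->
  (forall i, localization A P (u i)) ->
  exists b, [/\ A b, ~ P b & forall i, (i < n)%N -> A (b * u i)].
Proof.
move=> hP uD; have [_ _ _ _ [P1 Pp]] := hP.
elim: n => [|n [b [Ab nb bu]]]; first by exists 1; split=> //; exact: subring1.
have [c [d [Ac Ad nd eqc]]] := uD n.
exists (b * d); split; first exact: subringM.
  by move=> /(Pp _ _ Ab Ad)[].
move=> i; rewrite ltnS leq_eqVlt => /predU1P[->|lti].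
  rewrite eqc (_ : _ * _ = b * c); first exact: subringM.
  by field; rewrite (prime_neq0 hP).
by rewrite -mulrA mulrCA; apply: (subringM hA) => //; exact: bu.
Qed.

(* If [x] is integral over [A_Q] and [b] is a common denominator of the
   coefficients of its equation, then [b * x] is integral over [A]. *)
Lemma integrally_closed_localization P Q :
  prime_ideal A P -> prime_ideal A Q -> Q `<=` P ->
  integrally_closed (localization A P) -> integrally_closed (localization A Q).
Proof.
move=> hP hQ QP icP p x pmonic Dp rx.
have [_ _ _ _ [Q1 Qp]] := hQ.
have [b [Ab nb bp]] := common_denominator (size p) hQ Dp.
have b0 := prime_neq0 hQ nb.
have sp : size p = (size p).-1.+1.
  by rewrite prednK // lt0n size_poly_eq0 monic_neq0.
pose n := (size p).-1.
(* The polynomial with root [b * x]: it stays monic, and for [i < n] the coefficient has a factor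
   [b] that clears its denominator. *)
pose p' := \poly_(i < n.+1) (b ^+ (n - i) * p`_i).
have p'n : p'`_n = 1.
  rewrite coef_poly ltnS leqnn subnn mul1r -lead_coefE.
  exact/eqP.
have sp' : size p' = n.+1.
  by apply: size_poly_eq; rewrite subnn mul1r -lead_coefE (eqP pmonic) oner_eq0.
have : localization A P (b * x).
  apply: (icP p').
  - by rewrite monicE lead_coefE sp' p'n.
  - move=> i; rewrite coef_poly; case: ifP => [|_]; last first.
      exact/(subring0 (localization_subring hP)).
    rewrite ltnS leq_eqVlt => /predU1P[->|lti].
      rewrite subnn mul1r -lead_coefE (eqP pmonic).
      exact: (subring1 (localization_subring hP)).
    apply: (sub_localization hP); rewrite -(subnSK lti) exprSr -mulrA.
    by apply: (subringM hA); [exact: subringX|apply: bp; lia].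
  - apply/rootP; rewrite horner_poly.
    transitivity (b ^+ n * p.[x]); last by rewrite (rootP rx) mulr0.
    rewrite horner_coef sp mulr_sumr; apply: eq_bigr => i _.
    rewrite exprMn [in RHS](_ : b ^+ n = b ^+ (n - i) * b ^+ i); first ring.
    by rewrite -exprD subnK // -ltnS.
move=> /(localization_mono QP)[a [c [Aa Ac nc eqa]]].
have c0 := prime_neq0 hQ nc.
exists a, (b * c); split=> //; first exact: subringM.
  by move=> /(Qp _ _ Ab Ac)[].
apply: (mulfI b0); rewrite eqa; field; exact/andP.
Qed.

End Localization.

(* A noetherian integrally closed local domain with a single nonzero prime [M]
   is a valuation ring.  A maximal proper ideal of the form [(D : z)] is prime,
   hence equals [M]; as [z] is not integral, [M z] is not contained in [M], so
   that [M] is generated by [t = z^-1], and every nonzero element of the ring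
   is a power of [t] up to a unit. *)
Lemma discrete_valuation_ring (K : fieldType) (D M : set K) :
  subring_closed [in D] -> noetherian D -> integrally_closed D ->
  prime_ideal D M -> (forall x, D x -> ~ M x -> D x^-1) ->
  (forall Q, prime_ideal D Q -> (exists2 a, Q a & a != 0) -> Q = M) ->
  forall x y, D x -> D y -> D (x / y) \/ D (y / x).
Proof.
move=> hD noethD icD hM Dinv Munique x y Dx Dy.
have [MD M0 MA MM [M1 Mp]] := hM.
(* If [M] has no nonzero element, [D] is a field and the claim is immediate. *)
have [[a Ma a0]|noa] := pselect (exists2 a, M a & a != 0); last first.
  have [->|y0] := eqVneq y 0; first by right; rewrite mul0r; exact: subring0.
  left; apply: (subringM hD) => //; apply: Dinv => // My; apply: noa.
  by exists y.
(* The condition on [a * z] keeps the nonzero [a] in the colon ideal [I z], so that [Munique]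
   applies once [I z] is prime; [a^-1] is a first candidate. *)
pose P z := ~ D z /\ D (a * z).
pose I z : set K := [set f | D f /\ D (f * z)].
have hI z : P z -> ideal D (I z).
  move=> [nz az]; split.
  - by move=> f [].
  - by split; rewrite ?mul0r; exact: subring0.
  - by move=> f g [Df fz] [Dg gz]; split; rewrite ?mulrDl; exact: subringD.
  - by move=> b f Db [Df fz]; split; rewrite -?mulrA; exact: subringM.
have [|z [nz az] zmax] := noetherian_maximal hD noethD hI.
  exists a^-1; split; last by rewrite divff //; exact: subring1.
  by move=> /MM/(_ Ma); rewrite mulVf.
have IM : I z = M.
  apply: Munique; last by exists a => //; split=> //; exact: MD.
  have [ID I0 IA IMul] := hI z (conj nz az); split=> //; split.
    by case=> _; rewrite mul1r.
  move=> b c Db Dc [_ bcz]; have [Ib|nIb] := pselect (I z b); first by left.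
  (* Here [b * z] is outside [D] and its colon ideal contains [I z], so by maximality the two agree;
     [c] lies in the former. *)
  right; apply: (zmax (b * z)).
  - split; first by move=> Dbz; apply: nIb.
    by rewrite mulrCA; exact: subringM.
  - move=> f [Df fz]; split=> //.
    by rewrite mulrCA; exact: subringM.
  - by split=> //; rewrite mulrA (mulrC c).
have [t Mt nMt] : exists2 t, M t & ~ M (t * z).
  apply: contrapT => noM; apply: nz.
  have [s eqs] := noethD _ (prime_ideal_ideal hM).
  have [||p [pmonic Dp]] := @span_stable_integral _ _ hD s z; last exact: icD.
    apply: contrapT => nos; move/eqP: a0; apply.
    move: Ma; rewrite eqs => -[c _ ->]; rewrite big1 // => i _.
    apply/eqP; rewrite mulf_eq0; apply/orP; right; apply/negP => /negP s0.
    by apply: nos; exists s`_i => //; exact: mem_nth.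
  move=> f fs; rewrite -eqs; apply: contrapT => nf; apply: noM.
  by exists f => //; rewrite eqs; exact: mem_span.
have Iz f : M f -> D (f * z) by rewrite -IM => -[].
have z0 : z != 0 by apply: contra_notN nz => /eqP->; exact: subring0.
have Mz : M z^-1.
  have t0 : t != 0 by apply: contra_notN nMt => /eqP->; rewrite mul0r.
  rewrite (_ : z^-1 = (t * z)^-1 * t); last by field; rewrite t0 z0.
  by apply: MM => //; apply: Dinv => //; exact: Iz.
have power u : D u -> u != 0 -> exists n, D (u * z ^+ n) /\ D (u * z ^+ n)^-1.
  move=> Du u0; apply: contrapT => nou.
  have DM n : D (u * z ^+ n) -> M (u * z ^+ n).
    move=> Dn; apply: contrapT => nM; apply: nou.
    by exists n; split=> //; exact: Dinv.
  have Dn n : D (u * z ^+ n).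
    elim: n => [|n IHn]; first by rewrite mulr1.
    by rewrite exprSr mulrA; apply/Iz/DM.
  (* Dividing the relation for [u * z ^+ N] by [u * z ^+ N] itself writes 1 as a combination of
     positive powers of [z^-1], which puts 1 in [M]. *)
  have [N [c Dc]] := noetherian_seq hD noethD Dn.
  rewrite size_mkseq => eqN; apply: M1.
  rewrite -(divff (mulf_neq0 u0 (expf_neq0 N z0))) [X in X / _]eqN mulr_suml.
  apply: (ideal_sum (A := D) (F := fun i => c i * (mkseq _ N)`_i / _)).
    exact: prime_ideal_ideal.
  move=> i lti; rewrite nth_mkseq // -mulrA; apply: (MM) => //.
  rewrite (_ : _ / _ = z^-1 ^+ (N - i).-1 * z^-1).
    by apply: MM => //; apply: (subringX hD); exact: MD.
  rewrite -exprSr prednK ?subn_gt0 // -[in LHS](subnK (ltnW lti)) exprD exprVn.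
  by field; rewrite u0 !expf_neq0.
have [->|x0] := eqVneq x 0; first by left; rewrite mul0r; exact: subring0.
have [->|y0] := eqVneq y 0; first by right; rewrite mul0r; exact: subring0.
have [m [xm xmV]] := power _ Dx x0; have [n [yn ynV]] := power _ Dy y0.
wlog mn : x y Dx Dy x0 y0 m n xm xmV yn ynV / (m <= n)%N.
  move=> wlg; have [mn|/ltnW nm] := leqP m n; first exact: (wlg x y _ _ _ _ m n).
  by apply/or_comm; exact: (wlg y x _ _ _ _ n m).
right; rewrite (_ : y / x = y * z ^+ n * (x * z ^+ m)^-1 * z^-1 ^+ (n - m)).
  apply: (subringM hD); first exact: subringM.
  by apply: subringX => //; exact: MD.
rewrite (_ : z ^+ n = z ^+ (n - m) * z ^+ m) ?exprVn; last first.
  by rewrite -exprD subnK.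
by field; rewrite x0 !expf_neq0.
Qed.

(** The trace [Q] of [P] on an affine chart [A] lies strictly between 0 and the prime [p] of [O]. In
    dimension two no further prime fits between 0 and [Q], so [A_Q] is a discrete valuation ring,
    and it is contained in [O_P]. *)
Lemma surface_localization (k K : fieldType) (iota : {rmorphism k -> K})
    (X : set (set K)) (O P : set K) :
  algebraic_surface iota X -> normal_point X O -> prime_ideal O P ->
  (exists2 a, P a & a != 0) -> (exists2 f, nonunits O f & ~ P f) ->
  forall x, localization O P x \/ localization O P x^-1.
Proof.
move=> [[As affAs XE] _ [_ dimX]] [XO icO] hP [z Pz z0] [f mf nPf] x.
have := XO; rewrite XE => -[A AAs [p hp eqO]].
have AX Q : prime_ideal A Q -> X (localization A Q).
  by move=> hQ; rewrite XE; exists A => //; exists Q.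
have [[s eqA] Afrac] := affAs _ AAs.
have [hA _] : subalgebra iota A by rewrite eqA; exact: subalgebra_smallest.
have noethA : noetherian A by rewrite eqA; exact: noetherian_smallest_subalgebra.
rewrite -eqO in icO hP mf *; have AO := sub_localization hA hp.
have hO := localization_subring hA hp.
have [PO P0 _ PM [P1 Pp]] := hP.
have hQ := contract_prime hA hp hP; have Qp := contract_sub hA hp hP.
set Q := P `&` A in hQ Qp.
have hD := localization_subring hA hQ; have AD := sub_localization hA hQ.
(* The numerator of [f] is in [p], as [f] would otherwise be a unit, and outside [Q], as [f] is
   outside [P]. *)
have properQ : Q `<` p.
  split=> // pQ; have [[a [b [Aa Ab nb eqf]]] fu] := mf.
  have b0 := prime_neq0 hp nb.
  have pa : p a.
    apply: contrapT => npa; apply: (fu (b / a)); first by exists b, a.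
    by rewrite eqf; field; rewrite b0 (prime_neq0 hp npa).
  apply: nPf; rewrite eqf mulrC; apply: PM; first exact: localization_inv.
  by have [] := pQ _ pa.
have hzero : prime_ideal A [set 0].
  split=> //.
  - by move=> _ ->; exact: subring0.
  - by move=> _ _ -> ->; rewrite addr0.
  - by move=> a _ _ ->; rewrite mulr0.
  split; first by move=> /eqP; rewrite oner_eq0.
  by move=> a b _ _ /eqP; rewrite mulf_eq0 => /orP[] /eqP; [left|right].
have [M1 M2] : (forall Q', prime_ideal (localization A Q) Q' ->
    (exists2 a, Q' a & a != 0) -> Q' = localized_ideal A Q) /\
    (exists2 a, Q a & a != 0).
  split; last first.
    have [a [b [Aa Ab nb eqz]]] := PO _ Pz.
    have b0 := prime_neq0 hp nb; exists a.
      split=> //; rewrite (_ : a = b * z); first by apply: PM => //; exact: AO.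
      by rewrite eqz; field.
    by apply: contra z0; rewrite eqz => /eqP->; rewrite mul0r.
  move=> Q' hQ' [a Q'a a0]; have [Q'D _ _ Q'M _] := hQ'.
  have hC := contract_prime hA hQ hQ'; have CQ := contract_sub hA hQ hQ'.
  have numer b c : A b -> A c -> ~ Q c -> Q' (b / c) -> (Q' `&` A) b.
    move=> Ab Ac nc Q'bc; split=> //; have c0 := prime_neq0 hQ nc.
    by rewrite (_ : b = c * (b / c)); [apply: Q'M => //; exact: AD|field].
  have eqC : Q' `&` A = Q.
    apply/seteqP; split=> //; apply: contrapT => nsub.
    (* A chain of length 3, contradicting dimension two; the default [O] is read only past index 3,
       where nothing is required. *)
    pose c i := nth O [:: localization A [set 0]; localization A (Q' `&` A);
      localization A Q; O] i.
    suff /dimX : specialization_chain X 3 c by [].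
    split=> [[|[|[|[|]]]]|[|[|[|]]]] //= _; rewrite /c /=; try exact: AX.
    - apply: (localization_proper hA) => //; split.
        by move=> _ ->; case: hC.
      move=> sub0; have [b [d [Ab Ad nd eqa]]] := Q'D _ Q'a.
      have /sub0/= b0 : (Q' `&` A) b by apply: (numer _ d) => //; rewrite -eqa.
      by move: a0; rewrite eqa b0 mul0r eqxx.
    - exact: (localization_proper hA).
    - by rewrite -eqO; exact: (localization_proper hA).
  apply/seteqP; split=> [y Q'y|_ [b [c [Qb Ac nc ->]]]].
    have [b [c [Ab Ac nc eqy]]] := Q'D _ Q'y; exists b, c; split=> //.
    by rewrite -eqC; apply: (numer _ c) => //; rewrite -eqy.
  rewrite mulrC; apply: Q'M; first exact: localization_inv.
  by move: Qb; rewrite -eqC => -[].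
have dvr := discrete_valuation_ring hD (noetherian_localization hA hQ noethA)
  (integrally_closed_localization hA hp hQ Qp icO)
  (localized_ideal_prime hA hQ) (fun x => localization_unit hQ) M1.
have DO : localization A Q `<=` localization (localization A p) P.
  move=> _ [a [b [Aa Ab nb ->]]]; exists a, b; split=> //; try exact: AO.
  by move=> Pb; apply: nb.
have [a [b [Aa Ab b0 ->]]] := Afrac x.
by case: (dvr a b (AD _ Aa) (AD _ Ab)) => /DO ?; [left|right; rewrite invf_div].
Qed.

(** * Semivaluations *)

(** Once [n] exceeds [(t - s)^-1], the interval from [s * n] to [t * n] is longer than 1 and
    contains the first integer after [s * n]. *)
Lemma between_multiples (R : realType) (s t : R) : 0 <= s -> s < t ->
  exists n p : nat, s * n%:R < p%:R < t * n%:R.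
Proof.
move=> s0 st; have d0 : 0 < t - s by rewrite subr_gt0.
exists (Num.truncn (t - s)^-1).+1; set n := _.+1.
have lt1 : 1 < (t - s) * n%:R.
  rewrite -(ltr_pdivrMl _ _ d0) mulr1; exact: truncnS_gt.
have sn0 : 0 <= s * n%:R by rewrite mulr_ge0.
exists (Num.truncn (s * n%:R)).+1; rewrite truncnS_gt /=.
rewrite -natr1; apply: (@le_lt_trans _ _ (s * n%:R + 1)).
  by rewrite lerD2r truncn_le.
by rewrite -ltrBrDl -mulrBl.
Qed.

Section Semivaluations.
Variables (R : realType) (k K : fieldType) (iota : {rmorphism k -> K}).
Variable O : set K.

(** The conditions of [is_NL] on a function defined on all of [K], which avoids the subtype [O] in
    sums and products. *)
Definition normalized_semivaluation (u : K -> \bar R) :=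
  [/\ forall f, O f -> (0 <= u f)%E, u 0 = +oo%E,
      forall c, c != 0 -> u (iota c) = 0%E,
      (forall f g, O f -> O g -> u (f * g) = (u f + u g)%E) /\
      (forall f g, O f -> O g -> (Order.min (u f) (u g) <= u (f + g)%R)%E) &
      is_min (nonunits O) u 1%:E].

(* The valuation ring, in the fraction field of the local ring at the kernel of
   [u], of the composite of that local ring with [u]. *)
Definition link_ring (u : K -> \bar R) : set K :=
  [set x | exists a b, [/\ O a, O b, u b != +oo%E, (u b <= u a)%E & x = a / b]].

Hypotheses (hO : subring_closed [in O]) (Ok : forall c, O (iota c)).

Section OneSemivaluation.
Variables (u : K -> \bar R) (hu : normalized_semivaluation u).

Lemma semival_ge0 f : O f -> (0 <= u f)%E.
Proof. by case: hu => + _ _ _ _; exact. Qed.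

Lemma semival0 : u 0 = +oo%E.
Proof. by case: hu. Qed.

Lemma semivalM f g : O f -> O g -> u (f * g) = (u f + u g)%E.
Proof. by case: hu => _ _ _ [+ _] _; exact. Qed.

Lemma semivalD f g : O f -> O g -> (Order.min (u f) (u g) <= u (f + g)%R)%E.
Proof. by case: hu => _ _ _ [_ +] _; exact. Qed.

Lemma semival1 : u 1 = 0%E.
Proof.
by case: hu => _ _ + _ _ => /(_ 1 (oner_neq0 _)); rewrite rmorph1.
Qed.

Lemma semivalN f : O f -> u (- f) = u f.
Proof.
move=> Of; rewrite -mulN1r semivalM //; last exact/(subringN hO)/(subring1 hO).
have [_ _ + _ _] := hu => /(_ (-1)); rewrite oppr_eq0 oner_neq0 => /(_ isT).
by rewrite rmorphN1 => ->; rewrite add0e.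
Qed.

Lemma semivalX f n r : O f -> u f = r%:E -> u (f ^+ n) = (r * n%:R)%:E.
Proof.
move=> Of uf; elim: n => [|n IHn]; first by rewrite semival1 mulr0.
rewrite exprSr semivalM //; last exact: subringX.
by rewrite IHn uf -EFinD -natr1 mulrDr mulr1.
Qed.

Lemma semival_neq0 f : u f != +oo%E -> f != 0.
Proof. by apply: contraNneq => ->; rewrite semival0. Qed.

Lemma semival_fin_num f : O f -> u f != +oo%E -> u f \is a fin_num.
Proof.
move=> Of ufin; rewrite fin_numE ufin gt_eqF //.
by rewrite (lt_le_trans ltNy0) ?semival_ge0.
Qed.

Lemma semivalM_neqy f g : O f -> O g -> u f != +oo%E -> u g != +oo%E ->
  u (f * g) != +oo%E.
Proof.
move=> Of Og uf ug; rewrite semivalM // -ltey.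
by rewrite -ge0_fin_numE ?adde_ge0 ?semival_ge0 // fin_numD !semival_fin_num.
Qed.

Lemma semival_kernel_prime : prime_ideal O [set f | O f /\ u f = +oo%E].
Proof.
split.
- by move=> f [].
- by split; [exact: subring0|exact: semival0].
- move=> f g [Of uf] [Og ug]; split; first exact: subringD.
  by apply/eqP; rewrite -leye_eq -[leLHS]minxx -{1}uf -ug semivalD.
- move=> a f Oa [Of uf]; split; first exact: subringM.
  by rewrite semivalM // uf addey // gt_eqF // (lt_le_trans ltNy0) ?semival_ge0.
split; first by move=> [_]; rewrite semival1.
move=> a b Oa Ob [_ /eqP]; rewrite semivalM // => uab.
have [ua|ua] := eqVneq (u a) +oo%E; first by left.
right; split=> //; apply/eqP; apply: contraTT uab => ub.
by rewrite -semivalM // semivalM_neqy.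
Qed.

Lemma link_ring_fraction a b : O a -> O b -> u b != +oo%E -> (u b <= u a)%E ->
  link_ring u (a / b).
Proof. by move=> Oa Ob ub uab; exists a, b. Qed.

Lemma sub_link_ring : O `<=` link_ring u.
Proof.
move=> f Of; rewrite -[f]divr1; apply: link_ring_fraction => //.
- exact: subring1.
- by rewrite semival1.
- by rewrite semival1 semival_ge0.
Qed.

Lemma link_ring_subring : subring_closed [in link_ring u].
Proof.
apply: subringP; first exact/sub_link_ring/(subring1 hO).
  move=> _ _ [a [b [Oa Ob ub uab ->]]] [c [d [Oc Od ud ucd ->]]].
  rewrite (_ : _ - _ = (a * d - c * b) / (b * d)); last first.
    by field; rewrite !semival_neq0.
  have Oad := subringM hO Oa Od; have Ocb := subringM hO Oc Ob.
  apply: link_ring_fraction.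
  - by apply: subringD => //; exact: subringN.
  - exact: subringM.
  - exact: semivalM_neqy.
  - apply: le_trans (semivalD Oad (subringN hO Ocb)).
    rewrite semivalN // le_min !semivalM // leeD2r //=.
    by rewrite addeC leeD2r.
move=> _ _ [a [b [Oa Ob ub uab ->]]] [c [d [Oc Od ud ucd ->]]].
rewrite (_ : a / b * _ = (a * c) / (b * d)); last first.
  by field; rewrite !semival_neq0.
apply: link_ring_fraction; try exact: subringM.
  exact: semivalM_neqy.
by rewrite !semivalM // leeD.
Qed.

(** If [f] in the maximal ideal had an inverse [a / b], then [u f + u a = u b <= u a] with [u b]
    finite, against [1 <= u f]. *)
Lemma link_ring_dominates : dominates (link_ring u) O.
Proof.
split; first exact: sub_link_ring.
apply/seteqP; split=> [f [[_ fu] Of]|f mf].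
  by split=> // g /sub_link_ring; exact: fu.
have [Of _] := mf; split=> //; split; first exact: sub_link_ring.
move=> _ [a [b [Oa Ob ub uab ->]]] /(congr1 ( *%R^~ b)).
rewrite mul1r mulrA divfK ?semival_neq0 // => /(congr1 u); rewrite semivalM //.
have : (1%:E <= u f)%E by case: hu => _ _ _ _ [_]; exact.
move=> uf; apply/eqP; rewrite gt_eqF //.
have ubfin := semival_fin_num Ob ub.
rewrite -[ltLHS]add0e; apply: lt_le_trans (leeD uf uab).
by rewrite lteD2rE // lte_fin.
Qed.

Hypothesis total_kernel : forall x,
  let P := [set f | O f /\ u f = +oo%E] in
  localization O P x \/ localization O P x^-1.

(** Up to inversion an element is [a / b] with [u b] finite, and comparing [u a] with [u b] decides
    which of [a / b] and [b / a] belongs. *)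
Lemma link_ring_valuation_ring : valuation_ring (link_ring u).
Proof.
split=> [|x _]; first exact: link_ring_subring.
wlog : x / localization O [set f | O f /\ u f = +oo%E] x.
  move=> wlg; case: (total_kernel x) => [/wlg//|/wlg].
  by rewrite invrK => /or_comm.
move=> [a [b [Oa Ob nb ->]]].
have ub : u b != +oo%E by apply/eqP => ub; exact: nb.
have [uba|uab] := leP (u b) (u a); first by left; exact: link_ring_fraction.
right; rewrite invf_div; apply: link_ring_fraction => //; last exact: ltW.
by rewrite -ltey (lt_le_trans uab) // leey.
Qed.

Lemma link_ring_RZ : is_RZ iota O (link_ring u).
Proof.
split; [exact: link_ring_valuation_ring|by move=> c; exact/sub_link_ring|].
exact: link_ring_dominates.
Qed.

(** An [x] in [W] outside the link ring would be [b / a] with [u b < u a], which the second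
    condition excludes. This recognizes the rings in the definition of [pi]. *)
Lemma link_ring_unique (W : set K) :
  (forall a b, O a -> O b -> u b != +oo%E -> (u b <= u a)%E -> W (a / b)) ->
  (forall a b, O a -> O b -> a != 0 -> (u b < u a)%E -> ~ W (b / a)) ->
  W = link_ring u.
Proof.
move=> uW Wu; apply/seteqP; split; last first.
  by move=> _ [a [b [Oa Ob ub uab ->]]]; exact: uW.
move=> x Wx.
have [->|x0] := eqVneq x 0; first exact/(subring0 link_ring_subring).
have [_ /(_ _ x0)[//|[a [b [Oa Ob ub uab eqx]]]]] := link_ring_valuation_ring.
have eqx' : x = b / a by rewrite -[x]invrK eqx invf_div.
have a0 : a != 0.
  by apply: contra x0 => /eqP a0; rewrite eqx' a0 invr0 mulr0.
move: uab; rewrite le_eqVlt => /predU1P[eqab|ltab].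
  by rewrite eqx'; apply: link_ring_fraction; rewrite -?eqab.
by case: (Wu _ _ Oa Ob a0 ltab); rewrite -eqx'.
Qed.

End OneSemivaluation.

(* [link_ring u] determines which powers of [a] are at least as large as powers
   of an element [f] of value [1], hence [u a]. *)
Lemma link_ring_sub_eq u u' :
  normalized_semivaluation u -> normalized_semivaluation u' ->
  link_ring u `<=` link_ring u' -> forall a, O a -> u a = u' a.
Proof.
move=> hu hu' sub.
have cmp a b : O a -> O b -> u b != +oo%E -> (u b <= u a)%E -> (u' b <= u' a)%E.
  move=> Oa Ob ub uab; have [c [d [Oc Od ud udc eqab]]] : link_ring u' (a / b).
    by apply: sub; exact: link_ring_fraction.
  have b0 := semival_neq0 hu ub; have d0 := semival_neq0 hu' ud.
  have : u' (b * c) = u' (a * d).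
    by congr u'; transitivity (a / b * (b * d)); [rewrite eqab|]; field.
  rewrite !(semivalM hu') // => eqs.
  rewrite -(leeD2rE _ _ (semival_fin_num hu' Od ud)) -eqs.
  by rewrite leeD2l.
have [_ _ _ _ [[f mf uf] _]] := hu; have [_ _ _ _ [[g mg u'g] u'min]] := hu'.
have [Of _] := mf; have [Og _] := mg.
(* [f] has the least [u]-value in the maximal ideal, so [cmp] gives [u' f <= u' g = 1], and 1 is the
   minimum of [u']. *)
have u'f : u' f = 1%:E.
  apply/eqP; rewrite eq_le (u'min _ mf) andbT -u'g cmp // uf //.
  by case: hu => _ _ _ _ [_]; exact.
move=> a Oa.
have ufp p : u (f ^+ p) = p%:R%:E by rewrite (semivalX hu _ Of uf) mul1r.
have u'fp p : u' (f ^+ p) = p%:R%:E by rewrite (semivalX hu' _ Of u'f) mul1r.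
have OX b n : O b -> O (b ^+ n) by exact: subringX.
have u'a0 := semival_ge0 hu' Oa.
have [ua|ua] := eqVneq (u a) +oo%E.
  rewrite ua; apply/esym/eqP; rewrite -leye_eq leNgt; apply/negP => u'a.
  have fin : u' a \is a fin_num by rewrite ge0_fin_numE.
  pose p := (Num.truncn (fine (u' a))).+1.
  have : (u' (f ^+ p)%R <= u' a)%E.
    by apply: cmp; rewrite ?ua ?leey ?ufp //; exact: OX.
  by rewrite u'fp -(fineK fin) lee_fin leNgt truncnS_gt.
have /fineK := semival_fin_num hu Oa ua; set r := fine _ => /esym uar.
have u'fin : u' a \is a fin_num.
  rewrite ge0_fin_numE //.
  apply: (@le_lt_trans _ _ (u' (f ^+ (Num.truncn r).+1)%R)).
    by apply: cmp => //; [exact: OX|rewrite ufp uar lee_fin ltW ?truncnS_gt].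
  by rewrite u'fp ltey.
have /fineK := u'fin; set r' := fine _ => /esym u'ar.
have r0 : 0 <= r by rewrite -lee_fin -uar semival_ge0.
have r'0 : 0 <= r' by rewrite -lee_fin -u'ar.
rewrite uar u'ar; congr _%:E; apply/eqP; rewrite eq_le !leNgt.
apply/andP; split; apply/negP => /between_multiples[//|n [p /andP[ltp gtp]]].
  have : (u' (f ^+ p)%R <= u' (a ^+ n)%R)%E.
    apply: cmp; try exact: OX; first by rewrite ufp.
    by rewrite ufp (semivalX hu _ Oa uar) lee_fin ltW.
  by rewrite u'fp (semivalX hu' _ Oa u'ar) lee_fin leNgt ltp.
have : (u' (a ^+ n)%R <= u' (f ^+ p)%R)%E.
  apply: cmp; try exact: OX; rewrite (semivalX hu _ Oa uar) //.
  by rewrite ufp lee_fin ltW.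
by rewrite u'fp (semivalX hu' _ Oa u'ar) lee_fin leNgt gtp.
Qed.

End Semivaluations.

(** * The canonical map *)

Section RealValuations.
Variables (R : realType) (F : fieldType) (w : F -> \bar R) (V : set F).
Hypothesis hw : real_valuation w V.

Lemma real_valuation1 : w 1 = 0%E.
Proof.
case: hw => _ wfin wM _ _; have /fineK := wfin _ (oner_neq0 F).
have := wM 1 1; rewrite mulr1; case: (w 1) (wfin _ (oner_neq0 F)) => // r _.
by rewrite -EFinD => -[/eqP]; rewrite -subr_eq0 opprD addNKr oppr_eq0 => /eqP->.
Qed.

Lemma real_valuation_le_div x y : y != 0 -> (w y <= w x)%E = `[< V (x / y) >].
Proof.
move=> y0; case: hw => _ wfin wM _ VE.
rewrite -[x in LHS](divfK y0) wM VE -[leLHS]add0e leeD2rE; last exact: wfin.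
by apply/idP/asboolP.
Qed.

End RealValuations.

(** * Link rings and the images of valuations *)

Section Image.
Variables (R : realType) (k K : fieldType) (iota : {rmorphism k -> K}).
Variable O : set K.

(** Outside [O] the value [+oo] is a mere default. *)
Definition link_ext (v : NL R iota O) (x : K) : \bar R :=
  oapp (NL_val v) +oo%E (insub x).

Lemma link_extE v (f : O) : link_ext v (set_val f) = NL_val v f.
Proof. by rewrite /link_ext set_valE valK. Qed.

Lemma subring_elt x : O x -> exists f : O, set_val f = x.
Proof. by move=> Ox; exists (exist _ x (mem_set Ox)). Qed.

Lemma subring_eltP (f : O) : O (set_val f).
Proof. exact: set_mem (valP f). Qed.

Lemma link_ext_normalized v : subring_closed [in O] ->
  (forall c, O (iota c)) -> normalized_semivaluation iota O (link_ext v).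
Proof.
move=> hO Ok.
have [v0 voo vk [vM vD] [[m mm vm] vmin]] : is_NL iota (NL_val v).
  exact: set_mem (valP v).
split.
- by move=> _ /subring_elt[f <-]; rewrite link_extE.
- have [f f0] := subring_elt (subring0 hO).
  by rewrite -f0 link_extE; exact: voo.
- move=> c c0; have [f fc] := subring_elt (Ok c).
  by rewrite -fc link_extE; exact: vk fc.
- split=> _ _ /subring_elt[f <-] /subring_elt[g <-].
    have [h hfg] := subring_elt (subringM hO (subring_eltP f) (subring_eltP g)).
    by rewrite -hfg !link_extE; exact: vM.
  have [h hfg] := subring_elt (subringD hO (subring_eltP f) (subring_eltP g)).
  by rewrite -hfg !link_extE; exact: vD.
- split; first by exists (set_val m) => //; rewrite link_extE.
  move=> f mf; have [/subring_elt[f' ff'] _] := mf.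
  by move: mf; rewrite -ff' link_extE; exact: vmin.
Qed.

Lemma link_ext_inj v v' : (forall x, O x -> link_ext v x = link_ext v' x) ->
  v = v'.
Proof.
move=> eqv; apply: val_inj; apply/funext => f.
by have := eqv _ (subring_eltP f); rewrite !link_extE.
Qed.

Hypotheses (hO : subring_closed [in O]) (Ok : forall c, O (iota c)).
Hypothesis total_kernel : forall (v : NL R iota O) x,
  let P := [set f | O f /\ link_ext v f = +oo%E] in
  localization O P x \/ localization O P x^-1.

Lemma NL_ring_RZ v : is_RZ iota O (link_ring O (link_ext v)).
Proof.
by apply: link_ring_RZ => //; [exact: link_ext_normalized|exact: total_kernel].
Qed.

Definition NL_point (v : NL R iota O) : RZ iota O := exist _ _ (NL_ring_RZ v).

(** On nonzero elements of [O], [v] is a positive multiple of [w], so both order them alike, and [W]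
    is the ring of [w]. *)
Lemma image_by_rank_one_ring (W : set K) (v : NL R iota O) :
  dominates W O -> image_by_rank_one W (NL_val v) ->
  W = link_ring O (link_ext v).
Proof.
move=> [OW mW] [w [c [hw [[g mg wg] _] vw]]].
have hv := link_ext_normalized v hO Ok.
have [w0 wfin wM _ WE] := hw.
have g0 : g != 0 by apply/eqP => g0; move: wg; rewrite g0 w0.
have [Og _] := mg.
(* Otherwise [w g <= w 1] would put [g^-1] in [W], while domination makes [g] a nonunit of [W]. *)
have c0 : 0 < c.
  rewrite -lte_fin -wg ltNge; apply/negP.
  rewrite (_ : 0%:E = w 1); last by rewrite (real_valuation1 hw).
  rewrite (real_valuation_le_div hw) // => /asboolP.
  rewrite div1r => Wg; have : (nonunits W `&` O) g by rewrite mW.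
  by move=> [[_ /(_ _ Wg)]]; rewrite mulfV.
have uw x : O x -> x != 0 -> link_ext v x = (w x * c^-1%:E)%E.
  by move=> /subring_elt[f <-] f0; rewrite link_extE vw.
have uwle x y : O x -> O y -> x != 0 -> y != 0 ->
    (link_ext v x <= link_ext v y)%E = (w x <= w y)%E.
  by move=> Ox Oy x0 y0; rewrite !uw // lee_pmul2r // ?lte_fin ?invr_gt0.
apply: (link_ring_unique hO hv (total_kernel v)) => [a b Oa Ob ub|a b Oa Ob a0].
  have b0 := semival_neq0 hv ub.
  have [->|a0] := eqVneq a 0.
    by rewrite mul0r => _; apply: OW; exact: subring0.
  by rewrite uwle // (real_valuation_le_div hw) // => /asboolP.
have [->|b0] := eqVneq b 0; first by rewrite (semival0 hv) ltNge leey.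
rewrite ltNge uwle //; apply: contraNnot => Wba.
by rewrite (real_valuation_le_div hw) //; apply/asboolP.
Qed.

(** Elements of [O] with finite value are units of [W], and [rho] turns comparisons of such values
    into membership of quotients in [W']; numerators of infinite value fall in the maximal ideal of
    [W] or compare as usual. *)
Lemma image_by_residue_ring (W W' : set K) (v : NL R iota O) :
  valuation_ring W -> valuation_ring W' -> W' `<=` W -> dominates W' O ->
  image_by_residue W W' (NL_val v) -> W' = link_ring O (link_ext v).
Proof.
move=> [hW _] [hW' totW'] W'W [OW' mW'].
move=> [F [rho [w [c [[rho1 rhoD rhoM rhoS rho0] hw c0 vw voo]]]]].
have hv := link_ext_normalized v hO Ok.
have OW x : O x -> W x by move=> /OW'/W'W.
have uw x : O x -> ~ nonunits W x -> link_ext v x = (c%:E * w (rho x))%E.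
  by move=> /subring_elt[f <-] nf; rewrite link_extE vw.
have uoo x : O x -> nonunits W x -> link_ext v x = +oo%E.
  by move=> /subring_elt[f <-] nf; rewrite link_extE voo.
have unit x : O x -> link_ext v x != +oo%E -> ~ nonunits W x.
  by move=> Ox ux nx; move: ux; rewrite uoo.
have unitV x : W x -> ~ nonunits W x -> W x^-1.
  move=> Wx nx; apply: contrapT => nWx; apply: nx; split=> // g Wg xg.
  apply: nWx; suff <- : g = x^-1 by [].
  have x0 : x != 0.
    by apply/eqP => x0; move/eqP: xg; rewrite x0 mul0r eq_sym oner_eq0.
  by rewrite -[LHS](mulKf x0) xg mulr1.
have unit0 x : ~ nonunits W x -> x != 0.
  move=> nx; apply/eqP => x0; apply: nx; rewrite x0.
  split; first exact: subring0.
  by move=> g _ /eqP; rewrite mul0r eq_sym oner_eq0.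
have nW' x : nonunits W x -> W' x.
  have [->|x0 [Wx nx]] := eqVneq x 0; first by move=> _; exact: subring0.
  by have [//|/W'W/nx] := totW' x x0; rewrite mulfV.
(* By [nW'] the ring [W'] contains the kernel of [rho] on [W], hence is the full preimage of its
   image. *)
have W'rho x : W x -> (rho @` W') (rho x) -> W' x.
  move=> Wx [y W'y rhoxy]; have Wy := W'W _ W'y.
  have hN := subringN hW Wy.
  rewrite -(subrK y x); apply: (subringD hW') => //; apply: nW'.
  apply/(rho0 _ (subringD hW Wx hN)); rewrite rhoD // -rhoxy -rhoD //.
  rewrite subrr; apply/rho0; first exact: subring0.
  split; first exact: subring0.
  by move=> g _ /eqP; rewrite mul0r eq_sym oner_eq0.
have rhoN0 x : O x -> ~ nonunits W x -> rho x != 0.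
  by move=> Ox nx; apply/eqP => rx; apply/nx/(rho0 _ (OW _ Ox)).
have uwle x y : O x -> O y -> ~ nonunits W x -> ~ nonunits W y ->
    (link_ext v x <= link_ext v y)%E -> W' (y / x).
  move=> Ox Oy nx ny; rewrite !uw // lee_pmul2l ?lte_fin //.
  have rx0 := rhoN0 x Ox nx.
  have WxV := unitV _ (OW _ Ox) nx.
  rewrite (real_valuation_le_div hw) // => /asboolP hyx.
  apply: W'rho; first by apply: (subringM hW) => //; exact: OW.
  suff -> : rho (y / x) = rho y / rho x by [].
  apply: (mulIf rx0); rewrite divfK // -rhoM ?divfK ?unit0 //; last exact: OW.
  by apply: (subringM hW) => //; exact: OW.
apply: (link_ring_unique hO hv (total_kernel v)) =>
    [a b Oa Ob ub uba|a b Oa Ob a0 uab W'ba].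
  have nb := unit _ Ob ub; have WbV := unitV _ (OW _ Ob) nb.
  have [na|na] := pselect (nonunits W a); last exact: uwle.
  apply: nW'; split; first by apply: (subringM hW) => //; exact: OW.
  by move=> g Wg; rewrite -mulrA; apply: na.2; exact: subringM.
have ub : link_ext v b != +oo%E by rewrite -ltey (lt_le_trans uab) // leey.
have nb := unit _ Ob ub; have WbV := unitV _ (OW _ Ob) nb.
have Wba := W'W _ W'ba.
have na : ~ nonunits W a.
  move=> [_ /(_ (b / a * b^-1))]; apply; first exact: subringM.
  by field; rewrite a0 unit0.
have ra0 := rhoN0 a Oa na.
have : (w (rho a) <= w (rho b))%E.
  rewrite (real_valuation_le_div hw) //; apply/asboolP; exists (b / a) => //.
  apply: (mulIf ra0); rewrite -rhoM ?divfK //; exact: OW.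
by rewrite leNgt -(lte_pmul2l _ (_ : 0 < c%:E)%E) ?lte_fin // -!uw // uab.
Qed.

(** The ring [W j] that defines the image is the link ring itself, and the decreasing chain ends at
    [W r], the ring of [nu]. *)
Lemma image_ring (nu : RZ iota O) (v : NL R iota O) : is_image nu v ->
  RZ_ring nu `<=` link_ring O (link_ext v).
Proof.
move=> [r [W [j [[[r0 Wr] Wval Wdec _] /andP[j0 jr] Wj _ imj]]]].
have Wmono i : (0 < i <= r)%N -> W r `<=` W i.
  move=> /andP[i0 ir]; rewrite -(subnKC ir).
  have : (i + (r - i) <= r)%N by rewrite subnKC.
  elim: (r - i)%N => [|n IHn]; first by rewrite addn0 => _ x.
  rewrite addnS => lt_r; apply: subset_trans (IHn (ltnW lt_r)).
  by have [] := Wdec (i + n)%N; rewrite // lt_r addn_gt0 i0.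
rewrite -Wr; suff <- : W j = link_ring O (link_ext v) by apply: Wmono; rewrite j0.
case: eqP imj => [j1|/eqP j1] imj.
  by rewrite j1 in Wj *; exact: image_by_rank_one_ring.
have j1' : (0 < j.-1 < r)%N by lia.
apply: image_by_residue_ring imj => //.
- by have [] := Wval j.-1; last (by []); lia.
- by have [] := Wval j; last (by []); lia.
- by have [] := Wdec j.-1 j1'; rewrite prednK.
Qed.

End Image.

(** * Topology *)

Section RiemannZariskiTopology.
Variables (k K : fieldType) (iota : {rmorphism k -> K}) (O : set K).

(** A basic open set asks the ring to contain given elements, a condition inherited by larger
    rings. *)
Lemma RZ_specialization (nu mu : RZ iota O) (U : set (RZ iota O)) :
  RZ_ring nu `<=` RZ_ring mu -> open U -> U nu -> U mu.
Proof.
move=> sub [D sD <-] [A DA Anu]; exists A => //.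
exact: subset_trans sub.
Qed.

Lemma RZ_ringP (nu : RZ iota O) : is_RZ iota O (RZ_ring nu).
Proof. exact: (svalP nu). Qed.

(* An ultrafilter converges to the ring of the elements of [K] that belong to
   almost all of the valuation rings. *)
Lemma RZ_compact : compact [set: RZ iota O].
Proof.
rewrite compact_ultra => F UF _.
pose V : set K := [set x | F [set nu : RZ iota O | RZ_ring nu x]].
have FV x : (forall nu : RZ iota O, RZ_ring nu x) -> V x.
  by move=> hx; apply: filterS filterT => nu _; exact: hx.
have RZsub (nu : RZ iota O) : subring_closed [in RZ_ring nu].
  by have [[]] := RZ_ringP nu.
have Vsub : subring_closed [in V].
  apply: subringP.
  - by apply: FV => nu; exact: subring1.
  - move=> x y; apply: filterS2 => nu nux nuy.
    by apply: subringD => //; exact: subringN.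
  - by move=> x y; apply: filterS2 => nu; exact: subringM.
have Vval : valuation_ring V.
  split=> // x x0; have [] := in_ultra_setVsetC [set nu | RZ_ring nu x] UF.
    by left.
  move=> FnV; right; apply: filterS FnV => nu nx.
  by have [[_ /(_ _ x0)[/nx|]]] := RZ_ringP nu.
have OV : O `<=` V.
  by move=> x Ox; apply: FV => nu; have [_ _ [+ _]] := RZ_ringP nu; exact.
have hV : is_RZ iota O V.
  split=> //.
    by move=> c; apply: FV => nu; have [_ + _] := RZ_ringP nu; exact.
  split=> //; apply/seteqP; split=> [x [[_ Vx] Ox]|x mx].
    by split=> // y /OV; exact: Vx.
  have [Ox _] := mx; split=> //; split; first exact: OV.
  move=> y /filter_ex[nu nuy].
  have [_ _ [_ eqm]] := RZ_ringP nu.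
  by move: mx; rewrite -eqm => -[[_ +] _]; exact.
exists (exist _ V hV); split=> // U.
rewrite nbhsE => -[W [[D finD <-] [A DA AV]] WU].
apply: filterS WU _; suff FA : F (RZ_basic A).
  by apply: filterS FA => nu nuA; exists A.
have /finite_seqP[s eqA] := finD _ DA.
have {AV} : forall x, x \in s -> V x.
  by move=> x xs; apply: AV; rewrite eqA.
rewrite eqA; elim: s {eqA} => [_|x s IHs sV].
  by apply: filterS filterT => nu _ y.
have Fs : F (RZ_basic [set` s]).
  by apply: IHs => y ys; apply: sV; rewrite inE ys orbT.
apply: filterS2 Fs (sV _ (mem_head _ _)) => nu nus nux y /=.
by rewrite inE => /predU1P[->//|]; exact: nus.
Qed.

End RiemannZariskiTopology.

(** * Hausdorff spaces and compactness *)

Lemma hausdorff_injective (S T : topologicalType) (f : S -> T) :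
  continuous f -> injective f -> hausdorff_space T -> hausdorff_space S.
Proof.
move=> fcont finj hT p q pq; apply/finj/hT => A B /fcont pA /fcont qB.
by have [z [Az Bz]] := pq _ _ pA qB; exists (f z).
Qed.

Lemma hausdorff_NL (R : realType) (k K : fieldType)
    (iota : {rmorphism k -> K}) (O : set K) : hausdorff_space (NL R iota O).
Proof.
apply: (@hausdorff_injective _ {ptws O -> \bar R} set_val).
- exact: initial_continuous.
- exact: val_inj.
- by apply: hausdorff_product => _; exact: ereal_hausdorff.
Qed.

Lemma compact_hausdorff_homeomorphism (S T : topologicalType) (f : S -> T) :
  compact [set: S] -> hausdorff_space T -> continuous f -> injective f ->
  set_surj [set: S] [set: T] f -> homeomorphism f.
Proof.
move=> cS hT fcont finj fsurj; split=> //.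
have /choice[g gK] : forall y, exists x, f x = y.
  by move=> y; have [x _ <-] := fsurj y I; exists x.
have fK : cancel f g by move=> x; apply: finj; rewrite gK.
exists g; split=> //; apply/continuous_closedP => A clA.
rewrite (_ : g @^-1` A = f @` A).
  apply: compact_closed => //; apply: continuous_compact.
    exact: continuous_subspaceT.
  exact: subclosed_compact clA cS _.
by apply/seteqP; split=> [y Ay|_ [x Ax <-]] /=; [exists (g y)|rewrite fK].
Qed.

Theorem proposition5p1 (R : realType) (k : closedFieldType) (K : fieldType)
    (iota : {rmorphism k -> K}) (X : set (set K)) (x : set K)
    (X_surface : algebraic_surface iota X)
    (x_closed : closed_point X x) (x_normal : normal_point X x)
    (pi : RZ iota x -> NL R iota x) (pi_canonical : canonical_map pi)
    (H : topologicalType) (q : RZ iota x -> H)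
    (q_largest : largest_hausdorff_quotient q)
    (pit : H -> NL R iota x)
    (pit_continuous : continuous pit) (pit_q : pit \o q = pi) :
  homeomorphism pit.
Proof.
have [[qsurj qopen] hH _] := q_largest.
have qcont : continuous q by apply/continuousP => U; exact: (qopen U).1.
have [[As affAs XE] _ _] := X_surface.
have [xO xk xfrac] : [/\ subring_closed [in x], forall c, x (iota c) &
    forall z, exists a b, [/\ x a, x b, b != 0 & z = a / b]].
  have := x_normal.1; rewrite XE => -[A AAs [p hp <-]].
  have [[s eqA] Afrac] := affAs _ AAs.
  have [hA Ak] : subalgebra iota A by rewrite eqA; exact: subalgebra_smallest.
  have AO := sub_localization hA hp; split; first exact: localization_subring.
    by move=> c; exact/AO.
  move=> z; have [a [b [Aa Ab b0 ->]]] := Afrac z.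
  by exists a, b; split=> //; exact: AO.
have total (v : NL R iota x) z : let P := [set f | x f /\ link_ext v f = +oo%E] in
    localization x P z \/ localization x P z^-1.
  have hv := link_ext_normalized v xO xk; set P := [set f | _] => /=.
  (* A nonzero kernel is not maximal, since it misses an element of value 1, so
     [surface_localization] applies; at the zero kernel the localization is all of [K]. *)
  have [[f Pf f0]|noP] := pselect (exists2 f, P f & f != 0).
    apply: (surface_localization X_surface x_normal).
    - exact: semival_kernel_prime hv.
    - by exists f.
    - have [_ _ _ _ [[g mg vg] _]] := hv; exists g => // -[_].
      by rewrite vg.
  have [a [b [xa xb b0 ->]]] := xfrac z; left; exists a, b; split=> // Pb.
  by apply: noP; exists b.
have ring_pi nu : RZ_ring nu `<=` link_ring x (link_ext (pi nu)).
  exact: image_ring (pi_canonical nu).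
(* The open preimage of the complement of the closed point [q mu] would contain [mu] if it contained
   [nu]. *)
have q_spec nu mu : RZ_ring nu `<=` RZ_ring mu -> q nu = q mu.
  move=> sub; apply: contrapT => neq.
  have cl : closed [set q mu].
    exact/accessible_closed_set1/hausdorff_accessible.
  have op : open (q @^-1` ~` [set q mu]).
    by apply/(qopen _).1; rewrite openC.
  exact: (RZ_specialization sub op neq).
(* Thus [q nu] depends on [pi nu] alone, which gives injectivity of [pit]. *)
have q_point nu : q nu = q (NL_point xO xk total (pi nu)) by exact: q_spec.
apply: compact_hausdorff_homeomorphism => //.
- rewrite (_ : [set: H] = q @` [set: RZ iota x]).
    apply: continuous_compact; first exact: continuous_subspaceT.
    exact: RZ_compact.
  by apply/seteqP; split=> // y; exact: qsurj.
- exact: hausdorff_NL.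
- move=> y z; have [[nu _ <-] [mu _ <-]] := (qsurj y I, qsurj z I).
  have pitE nu' : pit (q nu') = pi nu' by rewrite -pit_q.
  by rewrite !pitE (q_point nu) (q_point mu) => ->.
(* The ring of the chosen point is the link ring of [v] and lies in that of its image, so
   [link_ring_sub_eq] identifies the image with [v]. *)
move=> v _; exists (q (NL_point xO xk total v)) => //.
rewrite -[LHS]/((pit \o q) _) pit_q; apply: link_ext_inj => f xf.
symmetry; apply: (link_ring_sub_eq xO) xf.
- exact: link_ext_normalized.
- exact: link_ext_normalized.
- exact: (ring_pi (NL_point xO xk total v)).
Qed.
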